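(* Suppose the plant graph $G_{\mathcal P}$ contains no isolated node and at least one sink, the control graph $G_{\mathcal K}$ is the complete graph (so $\mathcal K=\mathbb R^{n\times n}$), and the design graph $G_{\mathcal C}$ is the totally disconnected graph with self-loops (i.e. $S_{\mathcal C}=I_q$). If either $(S_{\mathcal P})_{11}$ is not diagonal or $(S_{\mathcal P})_{22}\neq 0$, then every control design method $\Gamma\in\mathcal C$ satisfies $$r_{\mathcal P}(\Gamma)\ge 1+\frac{1}{\epsilon^2}.$$
   Context: Fix integers $q\ge 1$ and $n_1,\dots,n_q\ge 1$, put $n=\sum_{i=1}^q n_i$, and fix a real $\epsilon>0$. Matrices $M\in\mathbb R^{n\times n}$ are partitioned into blocks $M_{ij}\in\mathbb R^{n_i\times n_j}$, $1\le i,j\le q$. Graphs are directed with vertex set $\{1,\dots,q\}$, possibly with self-loops. The adjacency matrix $S=(s_{ij})$ of $G=(\{1,\dots,q\},E)$ is $s_{ij}=1$ if $(j,i)\in E$ and $s_{ij}=0$ otherwise. A vertex $i$ is a sink if there is no $j\ne i$ with $(i,j)\in E$; it is isolated if there is no $j\ne i$ with $(i,j)\in E$ or $(j,i)\in E$. The complete graph contains all edges $(i,j)$, including self-loops. Plants: given the plant graph $G_{\mathcal P}$ with adjacency matrix $S_{\mathcal P}$, let $\mathcal A(S_{\mathcal P})=\{A\in\mathbb R^{n\times n}: A_{ij}=0 \text{ whenever } (s_{\mathcal P})_{ij}=0\}$, and let $\mathcal B(\epsilon)$ be the set of diagonal $n\times n$ matrices with all diagonal entries $\ge\epsilon$. The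 set of plants is $\mathcal P=\mathcal A(S_{\mathcal P})\times\mathcal B(\epsilon)\times\mathbb R^n$; $P=(A,B,x_0)$ stands for the system $x(k+1)=Ax(k)+Bu(k)$, $x(0)=x_0$. Controllers: given the control graph $G_{\mathcal K}$ with adjacency matrix $S_{\mathcal K}$, let $\mathcal K=\{K\in\mathbb R^{n\times n}: K_{ij}=0 \text{ whenever } (s_{\mathcal K})_{ij}=0\}$; $K$ acts by $u(k)=Kx(k)$. Cost: $J_P(K)=\sum_{k=1}^\infty x(k)^Tx(k)+\sum_{k=0}^\infty u(k)^Tu(k)\in[0,\infty]$, evaluated along the closed loop of $P$ with $u=Kx$. Design methods: a control design method is a map $\Gamma:\mathcal A(S_{\mathcal P})\times\mathcal B(\epsilon)\to\mathcal K$. Given a design graph $G_{\mathcal C}$ with adjacency matrix $S_{\mathcal C}$, $\mathcal C$ is the set of control design methods $\Gamma$ with structure $G_{\mathcal C}$, meaning that for each $i$ the block row $[\Gamma_{i1}\ \cdots\ \Gamma_{iq}]$ is a function only of $\{[A_{j1}\ \cdots\ A_{jq}],\,B_{jj}: (s_{\mathcal C})_{ij}\ne 0\}$. Competitive ratio: for each $P\in\mathcal P$ let $K^*(P)\in\mathcal K$ be an optimal controller, i.e. $J_P(K^*(P))\le J_P(K)$ for all $K\in\mathcal K$ (for complete $G_{\mathcal K}$ it exists: the linear quadratic regulator). Set $$r_{\mathcal P}(\Gamma)=\sup_{P=(A,B,x_0)\in\mathcal P}\frac{J_P(\Gamma(A,B))}{J_P(K^*(P))},$$ with the conventions $0/0=1$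 and $c/0=\infty$ for $c>0$. Sinks: let $c\ge 1$ be the number of sinks of $G_{\mathcal P}$, with vertices numbered so that the sinks are exactly $q-c+1,\dots,q$. Then $S_{\mathcal P}=\begin{bmatrix}(S_{\mathcal P})_{11}&0\\(S_{\mathcal P})_{21}&(S_{\mathcal P})_{22}\end{bmatrix}$, where $(S_{\mathcal P})_{11}$ is the $(q-c)\times(q-c)$ submatrix on the non-sinks and $(S_{\mathcal P})_{22}$ is the $c\times c$ (necessarily diagonal) submatrix on the sinks. *)

(* Defs.v *)
From HB Require Import structures.
From mathcomp Require Import all_boot all_order all_algebra.
From mathcomp Require Import all_classical all_reals all_analysis.
Set Implicit Arguments.
Unset Strict Implicit.
Unset Printing Implicit Defensive.
Import Order.TTheory GRing.Theory Num.Theory.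
Local Open Scope ring_scope.

(* A directed graph on 'I_q is a relation G : rel 'I_q, where G i j means that
   (i, j) is an edge. The transposition of indices below is intended. *)
Definition adjacency (q : nat) (G : rel 'I_q) : 'M[int]_q :=
  \matrix_(i, j) (if G j i then 1 else 0).

Definition sink (q : nat) (G : rel 'I_q) (i : 'I_q) : bool :=
  [forall j, (j != i) ==> ~~ G i j].

Definition isolated_vertex (q : nat) (G : rel 'I_q) (i : 'I_q) : bool :=
  [forall j, (j != i) ==> ~~ G i j && ~~ G j i].

Definition complete_graph (q : nat) (G : rel 'I_q) : Prop :=
  forall i j, G i j.

Section Plants.
Context (R : realType) (q : nat) (n_ : 'I_q -> nat).
Local Notation mat := 'M[R]_(\sum_i n_ i).
Local Notation vec := 'cV[R]_(\sum_i n_ i).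

(* Both A(S) (plant matrices) and K (controllers) are sets of this form. *)
Definition structured (S : 'M[int]_q) : set mat :=
  [set M | forall i j, S i j = 0 -> submxblock M i j = 0].

Definition input_matrices (eps : R) : set mat :=
  [set B | is_diag_mx B /\ forall k, eps <= B k k].

Fixpoint trajectory (A B : mat) (x0 : vec) (K : mat) (k : nat) : vec :=
  if k is k'.+1 then
    let x := trajectory A B x0 K k' in A *m x + B *m (K *m x)
  else x0.

Definition input (A B : mat) (x0 : vec) (K : mat) (k : nat) : vec :=
  K *m trajectory A B x0 K k.

Definition sqnorm (x : vec) : R := (x^T *m x) 0 0.

(* The state cost starts at k = 1, the input cost at k = 0. *)
Definition cost (A B : mat) (x0 : vec) (K : mat) : \bar R :=
  (\sum_(1 <= k <oo) (sqnorm (trajectory A B x0 K k))%:E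
   + \sum_(0 <= k <oo) (sqnorm (input A B x0 K k))%:E)%E.

Definition optimal (SK : 'M[int]_q) (A B : mat) (x0 : vec) (Kstar : mat) : Prop :=
  structured SK Kstar /\
  forall K, structured SK K -> (cost A B x0 Kstar <= cost A B x0 K)%E.

(* A design method is represented by a function on all pairs of matrices, but
   only its values on A(SP) x B(eps) are constrained (here) or used (in
   competitive_ratio). *)
Definition design_method (SP SK SC : 'M[int]_q) (eps : R)
    (Gamma : mat -> mat -> mat) : Prop :=
  (forall A B, structured SP A -> input_matrices eps B ->
     structured SK (Gamma A B)) /\
  (forall (i : 'I_q) (A B A' B' : mat),
     structured SP A -> input_matrices eps B ->
     structured SP A' -> input_matrices eps B' ->
     (forall j, SC i j != 0 ->
        submxcol A j = submxcol A' j /\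
        submxblock B j j = submxblock B' j j) ->
     submxcol (Gamma A B) i = submxcol (Gamma A' B') i).

(* The quotient with 0/0 = 1 and c/0 = +oo for c > 0. *)
Definition cost_ratio (a b : \bar R) : \bar R :=
  (if b == 0 then if a == 0 then 1 else +oo else a / b)%E.

(* The value of the ratio does not depend on which optimal controller Kstar is
   taken, since all of them have the same cost. A plant without an optimal
   controller would contribute nothing; for a complete control graph there is
   no such plant (linear quadratic regulator). *)
Definition competitive_ratio (SP SK : 'M[int]_q) (eps : R)
    (Gamma : mat -> mat -> mat) : \bar R :=
  ereal_sup [set r | exists (A B : mat) (x0 : vec) (Kstar : mat),
    [/\ structured SP A, input_matrices eps B, optimal SK A B x0 Kstar
      & r = cost_ratio (cost A B x0 (Gamma A B)) (cost A B x0 Kstar)]].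

End Plants.

(* Main.v *)
(* Two families of plants with inputs B = eps I and x(0) = e_j defeat every
   design in which subsystem i knows only its own block row.
   Relay: A = e_i e_j^T + s e_l e_i^T with i not in the block of j or l. The gain
   of i does not depend on s. If i does not cancel x_i(1), its error is amplified
   by s and the cost is unbounded, while the optimum stays below 1/eps^2; if it
   does cancel x_i(1), then at s = 0 it pays 1/eps^2 against 1/(1 + eps^2).
   Fork: A = r e_i e_j^T + s e_i e_i^T. Asymptotically, for s large and r = s^2,
   subsystem i alone must cancel x_i(1) at cost r^2/eps^2, whereas the optimal
   controller leaves x_i(1) nonzero and lets j compensate for it at the next
   step, at total cost r^2/(1 + eps^2). The gain of j is fixed by its zero row,
   and the sign of s is chosen so that this gain does not help.
   For these plants the Riccati equation reduces to a scalar quadratic equation,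
   which gives an optimal controller explicitly. *)
Require Import Defs.
From HB Require Import structures.
From mathcomp Require Import all_boot all_order all_algebra.
From mathcomp Require Import all_classical all_reals all_analysis.
From mathcomp Require Import ring lra.
Set Implicit Arguments.
Unset Strict Implicit.
Unset Printing Implicit Defensive.
Import Order.TTheory GRing.Theory Num.Theory.
Local Open Scope ring_scope.

(** * Coordinates and squared norms *)

Lemma delta_mulmxE (R : pzRingType) (n : nat) (a b : 'I_n) (x : 'cV[R]_n) k :
  (delta_mx a b *m x) k 0 = (k == a)%:R * x b 0.
Proof.
rewrite mxE (bigD1 b)//= !mxE eqxx andbT big1 ?addr0// => l lb.
by rewrite mxE (negPf lb) andbF mul0r.
Qed.

Section SquaredNorm.
Context (R : realType) (q : nat) (n_ : 'I_q -> nat).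
Implicit Types x : 'cV[R]_(\sum_i n_ i).

Lemma sqnormE x : sqnorm x = \sum_k x k 0 ^+ 2.
Proof. by rewrite /sqnorm mxE; apply: eq_bigr => k _; rewrite mxE. Qed.

Lemma sqnorm_ge0 x : 0 <= sqnorm x.
Proof. by rewrite sqnormE sumr_ge0// => k _; rewrite sqr_ge0. Qed.

Lemma sqnorm_ge1 x a : x a 0 ^+ 2 <= sqnorm x.
Proof.
rewrite sqnormE (bigD1 a)//= lerDl sumr_ge0// => k _.
by rewrite sqr_ge0.
Qed.

Lemma sqnorm_ge2 x a b : a != b -> x a 0 ^+ 2 + x b 0 ^+ 2 <= sqnorm x.
Proof.
move=> ab; rewrite sqnormE (bigD1 a)//= (bigD1 b)/=; last by rewrite eq_sym.
by rewrite addrA lerDl sumr_ge0// => k _; rewrite sqr_ge0.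
Qed.

Lemma sqnorm_supp2 x a b : a != b ->
  (forall k, k != a -> k != b -> x k 0 = 0) ->
  sqnorm x = x a 0 ^+ 2 + x b 0 ^+ 2.
Proof.
move=> ab x0; rewrite sqnormE (bigD1 a)//= (bigD1 b)/=; last by rewrite eq_sym.
rewrite [X in _ + (_ + X)]big1 ?addr0// => k /andP[ka kb].
by rewrite x0// expr0n.
Qed.

End SquaredNorm.

(** * Closed-loop costs, dynamic programming and cost ratios *)

Section Costs.
Context (R : realType) (q : nat) (n_ : 'I_q -> nat).
Local Notation mat := 'M[R]_(\sum_i n_ i).
Local Notation vec := 'cV[R]_(\sum_i n_ i).
Implicit Types A B K : mat.

(** The state cost starts one step after the input cost, so u(k) is paired with x(k+1). *)
Definition stage_cost A B x0 K k : R :=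
  sqnorm (trajectory A B x0 K k.+1) + sqnorm (input A B x0 K k).

Lemma stage_cost_ge0 A B x0 K k : 0 <= stage_cost A B x0 K k.
Proof. by rewrite addr_ge0// sqnorm_ge0. Qed.

Lemma cost_series A B x0 K :
  cost A B x0 K = (\sum_(0 <= k <oo) (stage_cost A B x0 K k)%:E)%E.
Proof.
rewrite /cost -(nneseries_addn 1); last by move=> k; rewrite lee_fin sqnorm_ge0.
rewrite -nneseriesD; try by move=> k _ _; rewrite lee_fin sqnorm_ge0.
by apply: eq_eseriesr => k _; rewrite -EFinD addn1.
Qed.

Lemma cost_ge_sum A B x0 K N :
  ((\sum_(0 <= k < N) stage_cost A B x0 K k)%:E <= cost A B x0 K)%E.
Proof.
rewrite cost_series -sumEFin; apply: nneseries_lim_ge => k _ _.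
by rewrite lee_fin stage_cost_ge0.
Qed.

Lemma cost_le A B x0 K c :
  (forall N, \sum_(0 <= k < N) stage_cost A B x0 K k <= c) ->
  (cost A B x0 K <= c%:E)%E.
Proof.
move=> leN; rewrite cost_series; apply: lime_le.
  by apply: is_cvg_nneseries => k _ _; rewrite lee_fin stage_cost_ge0.
by apply: nearW => N; rewrite sumEFin lee_fin.
Qed.

Lemma cost_ge_input A B x0 K a :
  (((K *m x0) a 0 ^+ 2)%:E <= cost A B x0 K)%E.
Proof.
apply: le_trans (cost_ge_sum A B x0 K 1); rewrite lee_fin big_nat1.
rewrite /stage_cost; apply: le_trans (sqnorm_ge1 _ a) _.
by rewrite lerDr sqnorm_ge0.
Qed.

(** Two steps suffice to penalise a design: an input spent at [a] at time 0, then either an input or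
    a residual state at [b]. *)
Lemma cost_ge2 A B x0 K a b :
  ((input A B x0 K 0 a 0 ^+ 2 + (input A B x0 K 1 b 0 ^+ 2
    + trajectory A B x0 K 2 b 0 ^+ 2))%:E <= cost A B x0 K)%E.
Proof.
apply: le_trans (cost_ge_sum A B x0 K 2).
rewrite lee_fin big_nat_recr//= big_nat1 /stage_cost.
have := sqnorm_ge1 (input A B x0 K 0) a.
have := sqnorm_ge1 (input A B x0 K 1) b.
have := sqnorm_ge1 (trajectory A B x0 K 2) b.
have := sqnorm_ge0 (trajectory A B x0 K 1); lra.
Qed.

(* The Bellman inequality telescopes. If J(K) = V x0 - d with d > 0, then
   V x(k) >= d for all k, so every stage costs at least d / M and J(K) = oo. *)
Lemma bellman_optimal A B K0 x0 (V : vec -> R) (M : R) (SK : 'M[int]_q) :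
  structured SK K0 ->
  (forall x, 0 <= V x) -> 0 < M -> (forall x, V x <= M * sqnorm x) ->
  (forall x u y, y = A *m x + B *m u -> V x <= sqnorm y + sqnorm u + V y) ->
  (forall x u y, u = K0 *m x -> y = A *m x + B *m u ->
     V x = sqnorm y + sqnorm u + V y) ->
  optimal SK A B x0 K0 /\ cost A B x0 K0 = (V x0)%:E.
Proof.
move=> hK0 V0 M0 VM Vle Veq.
have ge K : ((V x0)%:E <= cost A B x0 K)%E.
  have tele N : V x0 <=
      \sum_(0 <= k < N) stage_cost A B x0 K k + V (trajectory A B x0 K N).
    elim: N => [|N IH]; first by rewrite big_geq// add0r.
    apply: le_trans IH _; rewrite big_nat_recr//= -addrA lerD2l.
    exact: Vle.
  case E : (cost A B x0 K) => [c| |]; last 2 first.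
  - by rewrite leey.
  - have := cost_ge_sum A B x0 K 0; rewrite E big_geq//.
  rewrite lee_fin leNgt; apply/negP => cV.
  pose d := V x0 - c.
  have d0 : 0 < d by rewrite subr_gt0.
  have sumle N : \sum_(0 <= k < N) stage_cost A B x0 K k <= c.
    by have := cost_ge_sum A B x0 K N; rewrite E lee_fin.
  have stage k : d / M <= stage_cost A B x0 K k.
    have := tele k.+1; have := sumle k.+1.
    have := VM (trajectory A B x0 K k.+1).
    have := sqnorm_ge0 (input A B x0 K k).
    move=> u0 VMk sumc Vx0.
    rewrite ler_pdivrMr// /stage_cost mulrDl.
    have : 0 <= sqnorm (input A B x0 K k) * M by rewrite mulr_ge0// ltW.
    by rewrite /d; lra.
  have lin N : d / M * N%:R <= c.
    apply: le_trans (sumle N); rewrite big_mkord.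
    rewrite mulr_natr -[N in X in X <= _]card_ord -sumr_const.
    by apply: ler_sum.
  have dM : 0 < d / M by rewrite divr_gt0.
  have := lin (Num.truncn (c / (d / M))).+1.
  rewrite mulrC -ler_pdivlMr// leNgt => /negP; apply.
  by rewrite truncnS_gt.
have eqK0 : cost A B x0 K0 = (V x0)%:E.
  (* Along [K0] the telescoped sum is exact, and [V >= 0] bounds every partial sum by [V x0]. *)
  apply/eqP; rewrite eq_le ge andbT; apply: cost_le => N.
  suff -> : V x0 = \sum_(0 <= k < N) stage_cost A B x0 K0 k
      + V (trajectory A B x0 K0 N) by rewrite lerDl.
  elim: N => [|N IH]; first by rewrite big_geq// add0r.
  by rewrite IH big_nat_recr//= -addrA; congr (_ + _); exact: Veq.
by split=> //; split=> // K _; rewrite eqK0.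
Qed.

Lemma cost_ratio_ge (r b : R) (a : \bar R) : 0 < b ->
  ((r * b)%:E <= a)%E -> (r%:E <= cost_ratio a b%:E)%E.
Proof.
move=> b0 rba; rewrite /cost_ratio eqe gt_eqF//.
by rewrite inver gt_eqF// lee_pdivlMr.
Qed.

Lemma competitive_ratio_ge (SP SK : 'M[int]_q) (eps : R) Gamma A B x0 Ks (r b : R) :
  structured SP A -> input_matrices eps B ->
  optimal SK A B x0 Ks /\ cost A B x0 Ks = b%:E -> 0 < b ->
  ((r * b)%:E <= cost A B x0 (Gamma A B))%E ->
  (r%:E <= competitive_ratio SP SK eps Gamma)%E.
Proof.
move=> hA hB [opt costK] b0 rb.
apply: le_trans (cost_ratio_ge b0 rb) _; apply: ereal_sup_ubound.
by exists A, B, x0, Ks; rewrite costK.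
Qed.

End Costs.

(** * Scalar Riccati equations *)

Section Scalars.
Context (R : realType).
Implicit Types a b c e r s : R.

Lemma exists_nonneg_quadratic_root a b c : 0 < a -> 0 <= c ->
  exists2 x, 0 <= x & a * x ^+ 2 + b * x = c.
Proof.
move=> a0 c0; have D0 : 0 <= b ^+ 2 + 4 * a * c.
  by rewrite addr_ge0 ?sqr_ge0// !mulr_ge0// ltW.
have sD := sqr_sqrtr D0.
exists ((Num.sqrt (b ^+ 2 + 4 * a * c) - b) / (2 * a)).
  rewrite divr_ge0 ?mulr_ge0 ?(ltW a0)// subr_ge0.
  rewrite (le_trans (ler_norm b))// -sqrtr_sqr ler_wsqrtr//.
  by rewrite lerDl !mulr_ge0// ltW.
move: sD; set S := Num.sqrt _ => sD.
apply: (mulfI (lt0r_neq0 a0)); apply: (mulfI (_ : 4 != 0)) => //.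
have -> : 4 * (a * (a * ((S - b) / (2 * a)) ^+ 2 + b * ((S - b) / (2 * a))))
  = S ^+ 2 - b ^+ 2 by field; exact: lt0r_neq0.
by rewrite sD; ring.
Qed.

(* Completing the square: v z^2 is the minimum over u of the left-hand side. *)
Lemma stage_min (eps H v z u : R) : v * (1 + eps ^+ 2 * H) = H ->
  u ^+ 2 + H * (z + eps * u) ^+ 2 =
  v * z ^+ 2 + (1 + eps ^+ 2 * H) * (u + eps * v * z) ^+ 2.
Proof.
move=> E; apply/eqP; rewrite -subr_eq0; apply/eqP.
transitivity ((H - v * (1 + eps ^+ 2 * H))
    * (z ^+ 2 + 2 * eps * z * u + eps ^+ 2 * v * z ^+ 2)); first by ring.
by rewrite E subrr mul0r.
Qed.

(** The relay with l different from j, where [e] is [eps ^+ 2]. Both equations have the form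
    required by [stage_min]: the next x_i has weight [1 + s ^+ 2 * v], and the next x_l, which is
    not passed on, has weight 1. *)
Lemma chain_riccati_root e s : 0 < e -> exists p v, [/\ 0 <= p, 0 <= v,
  p * (1 + e * (1 + s ^+ 2 * v)) = 1 + s ^+ 2 * v & v * (1 + e) = 1].
Proof.
move=> e0; have e1 : 0 < 1 + e by lra.
pose v := (1 + e)^-1; have v0 : 0 <= v by rewrite invr_ge0 ltW.
have t0 : 0 <= s ^+ 2 * v by rewrite mulr_ge0// sqr_ge0.
have D0 : 0 < 1 + e * (1 + s ^+ 2 * v).
  by rewrite addrC ltr_wpDl// ?mulr_ge0 ?addr_ge0// ltW.
exists ((1 + s ^+ 2 * v) / (1 + e * (1 + s ^+ 2 * v))), v; split => //.
- by rewrite divr_ge0 ?(ltW D0)// addr_ge0.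
- by rewrite divfK// lt0r_neq0.
- by rewrite mulVf// lt0r_neq0.
Qed.

(** The relay with l equal to j: x_l feeds i again, so its weight is [1 + p]. Eliminating [v] leaves
    a quadratic equation for [p]. *)
Lemma cycle_riccati_root e s : 0 < e -> exists p v, [/\ 0 <= p, 0 <= v,
  p * (1 + e * (1 + s ^+ 2 * v)) = 1 + s ^+ 2 * v & v * (1 + e * (1 + p)) = 1 + p].
Proof.
move=> e0; have s0 := sqr_ge0 s.
have [||p p0 Ep] := @exists_nonneg_quadratic_root (e * (1 + e) + e * s ^+ 2)
    ((1 + e) ^+ 2 + e * s ^+ 2 - e - s ^+ 2) (1 + e + s ^+ 2).
- apply: ltr_pwDl; first by rewrite mulr_gt0// ltr_wpDl.
  by rewrite mulr_ge0// ltW.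
- lra.
have D0 : 0 < 1 + e * (1 + p).
  by rewrite addrC ltr_wpDl// mulr_ge0 ?addr_ge0// ltW.
exists p, ((1 + p) / (1 + e * (1 + p))); split => //.
- by rewrite divr_ge0 ?(ltW D0)// addr_ge0.
- apply: (mulIf (lt0r_neq0 D0)).
  have -> : p * (1 + e * (1 + s ^+ 2 * ((1 + p) / (1 + e * (1 + p)))))
    * (1 + e * (1 + p)) = p * ((1 + e) * (1 + e * (1 + p)) + e * s ^+ 2 * (1 + p)).
    by field; exact: lt0r_neq0.
  have -> : (1 + s ^+ 2 * ((1 + p) / (1 + e * (1 + p)))) * (1 + e * (1 + p))
    = 1 + e * (1 + p) + s ^+ 2 * (1 + p) by field; exact: lt0r_neq0.
  apply/eqP; rewrite -subr_eq0; apply/eqP; move/eqP: Ep; rewrite -subr_eq0 => /eqP Ep.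
  by rewrite -[RHS]Ep; ring.
- by rewrite divfK// lt0r_neq0.
Qed.

(* a and b are the optimal next states of the two coordinates, per unit of
   z = r x_j + s x_i; the optimal cost is w z^2. *)
Lemma fork_riccati_root (eps r s : R) : 0 < eps -> r != 0 -> exists w a b,
  [/\ 0 < w,
    w <= (1 + s ^+ 2 / (eps ^+ 2 * (r ^+ 2 + s ^+ 2))) / (1 + eps ^+ 2),
    (1 + eps ^- 2) * a + w * s * (s * a + r * b) = eps ^- 2,
    (1 + eps ^- 2) * b + w * r * (s * a + r * b) = 0
  & w = eps ^- 2 - eps ^- 2 * a].
Proof.
move=> eps0 r0; have e0 : 0 < eps ^+ 2 by rewrite exprn_gt0.
have N0 : 0 < r ^+ 2 + s ^+ 2 by rewrite ltr_pwDl ?sqr_ge0// exprn_even_gt0.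
set e := eps ^+ 2 in e0 *; set N := r ^+ 2 + s ^+ 2 in N0 *.
have al0 : 0 < 1 + e^-1 by rewrite addr_gt0// invr_gt0.
have e1 : 0 < 1 + e by rewrite addr_gt0.
(* This quadratic is what remains for [w] after [a] and [b] are eliminated from the three equations
   of the conclusion. *)
have [||w w0 Ew] := @exists_nonneg_quadratic_root N
    (1 + e^-1 - (N + s ^+ 2 / e) / (1 + e)) ((1 + e^-1) / (1 + e)).
- by [].
- by rewrite divr_ge0// ltW.
set D := 1 + e^-1 + w * N.
have D0 : 0 < D by apply: ltr_pwDl => //; rewrite mulr_ge0// ltW.
have wD : (1 + e) * (w * D) = D + w * s ^+ 2 / e.
  transitivity ((1 + e) * (N * w ^+ 2
    + (1 + e^-1 - (N + s ^+ 2 / e) / (1 + e)) * w) + (N + s ^+ 2 / e) * w).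
    by rewrite /D; field; rewrite !lt0r_neq0.
  by rewrite Ew /D; field; rewrite !lt0r_neq0.
have w_gt0 : 0 < w.
  rewrite lt0r w0 andbT; apply/eqP => w_eq0; move: wD.
  by rewrite w_eq0 !mul0r mulr0 addr0 => /eqP; rewrite lt_eqF.
have De0 : 0 < e + 1 + w * (r ^+ 2 + s ^+ 2) * e.
  have -> : e + 1 + w * (r ^+ 2 + s ^+ 2) * e = e * D.
    by rewrite /D /N; field; rewrite lt0r_neq0.
  by rewrite mulr_gt0.
pose b := - (w * r * s / (e * D)) / (1 + e^-1).
have zE : s * (1 - e * w) + r * b = s / (e * D).
  have -> : s * (1 - e * w) + r * b =
    s / (e * D) + e * s / ((1 + e) * D) * (D + w * s ^+ 2 / e - (1 + e) * (w * D)).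
    by rewrite /b /D /N; field; rewrite !lt0r_neq0.
  by rewrite wD subrr mulr0 addr0.
exists w, (1 - e * w), b; split => //.
(* By [wD], [(1 + e) * w = 1 + w * s ^+ 2 / (e * D)], and [w * N <= D]. *)
- rewrite ler_pdivlMr// -(ler_pM2r D0).
  have -> : w * (1 + e) * D = (1 + e) * (w * D) by ring.
  rewrite wD mulrDl mul1r lerD2l.
  have -> : s ^+ 2 / (e * N) * D = w * s ^+ 2 / e + s ^+ 2 / (e * N) * (1 + e^-1).
    by rewrite /D; field; rewrite !lt0r_neq0.
  by rewrite lerDl mulr_ge0 ?(ltW al0)// divr_ge0 ?sqr_ge0// mulr_ge0// ltW.
- rewrite zE; apply: (mulIf (lt0r_neq0 D0)).
  transitivity ((1 + e^-1) * D - (1 + e) * (w * D) + w * s ^+ 2 / e).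
    by field; rewrite !lt0r_neq0.
  by rewrite wD; field; rewrite !lt0r_neq0.
- by rewrite zE /b; field; rewrite !lt0r_neq0// addrC.
- by field; rewrite lt0r_neq0.
Qed.

End Scalars.

(** * Optimal controllers for the relay and fork plants *)

Section Plants.
Context (R : realType) (q : nat) (n_ : 'I_q -> nat) (SK : 'M[int]_q) (eps : R).
Local Notation n := (\sum_i n_ i)%N.
Context (SK_full : forall K : 'M[R]_n, structured SK K) (eps_gt0 : 0 < eps).
Implicit Types (i j l k : 'I_n) (x u : 'cV[R]_n).

Definition relay_plant i j l (s : R) : 'M[R]_n :=
  delta_mx i j + s *: delta_mx l i.

Definition fork_plant i j (r s : R) : 'M[R]_n :=
  r *: delta_mx i j + s *: delta_mx i i.

Lemma relay_plantE i j l s x k : (relay_plant i j l s *m x) k 0 =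
  (k == i)%:R * x j 0 + s * ((k == l)%:R * x i 0).
Proof.
by rewrite mulmxDl -scalemxAl !mxE [RHS]addrC [LHS]addrC -!delta_mulmxE !mxE.
Qed.

Lemma fork_plantE i j r s x k : (fork_plant i j r s *m x) k 0 =
  (k == i)%:R * (r * x j 0 + s * x i 0).
Proof.
rewrite mulmxDl -!scalemxAl mxE [X in X + _]mxE [X in _ + X]mxE !delta_mulmxE.
by ring.
Qed.

(** The plant sends x_j only to i and x_i only to l, so the cost-to-go separates into
    [p * x_j ^+ 2 + t * x_i ^+ 2]. The bounds on [p] follow from its form
    [(1 + t) / (1 + eps ^+ 2 * (1 + t))] with [t = s ^+ 2 * v]. *)
Lemma relay_plant_optimal i j l s : i != j -> i != l ->
  exists K p, [/\ 0 < p, p <= eps ^- 2, s = 0 -> p = (1 + eps ^+ 2)^-1 &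
    optimal SK (relay_plant i j l s) eps%:M (delta_mx j 0) K /\
    cost (relay_plant i j l s) eps%:M (delta_mx j 0) K = p%:E].
Proof.
move=> ij il; have e0 : 0 < eps ^+ 2 by rewrite exprn_gt0.
(* The factor [(l == j)%:R] treats chain and cycle together: x_l carries the extra weight [p]
   exactly when l is j. *)
have [p [v [p0 v0 Ep Ev]]] : exists p v, [/\ 0 <= p, 0 <= v,
    p * (1 + eps ^+ 2 * (1 + s ^+ 2 * v)) = 1 + s ^+ 2 * v &
    v * (1 + eps ^+ 2 * (1 + (l == j)%:R * p)) = 1 + (l == j)%:R * p].
  case: (l == j) => /=.
    have [p [v [p0 v0 Ep Ev]]] := cycle_riccati_root s e0.
    by exists p, v; rewrite mul1r.
  have [p [v [p0 v0 Ep Ev]]] := chain_riccati_root s e0.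
  by exists p, v; rewrite mul0r addr0 mulr1.
set t := s ^+ 2 * v in Ep.
have t0 : 0 <= t by rewrite mulr_ge0// sqr_ge0.
have D0 : 0 < 1 + eps ^+ 2 * (1 + t).
  by rewrite addrC ltr_wpDl// mulr_ge0 ?addr_ge0// ltW.
have pE : p = (1 + t) / (1 + eps ^+ 2 * (1 + t)).
  by apply: (mulIf (lt0r_neq0 D0)); rewrite Ep divfK// lt0r_neq0.
have p_gt0 : 0 < p by rewrite pE divr_gt0// ltr_wpDr.
pose K : 'M[R]_n := (- eps * p) *: delta_mx i j + (- eps * v * s) *: delta_mx l i.
have KE x k : (K *m x) k 0 =
    - eps * p * ((k == i)%:R * x j 0) + - eps * v * s * ((k == l)%:R * x i 0).
  rewrite mulmxDl -!scalemxAl mxE [X in X + _]mxE [X in _ + X]mxE.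
  by rewrite !delta_mulmxE.
pose V x : R := p * x j 0 ^+ 2 + t * x i 0 ^+ 2.
exists K, p; split => //.
- rewrite pE ler_pdivrMr// mulrDr mulr1 mulKf ?lt0r_neq0// lerDr.
  by rewrite invr_ge0 ltW.
- by move=> s_eq0; rewrite pE /t s_eq0 expr0n mul0r addr0 mulr1 div1r.
have -> : p = V (delta_mx j 0).
  by rewrite /V !mxE eqxx (negPf ij) expr1n expr0n mulr0 addr0 mulr1.
have next_stateE x u y : y = relay_plant i j l s *m x + eps%:M *m u ->
    forall k, y k 0 =
      (k == i)%:R * x j 0 + s * ((k == l)%:R * x i 0) + eps * u k 0.
  by move=> -> k; rewrite mul_scalar_mx mxE relay_plantE mxE.
have next_i x u y : y = relay_plant i j l s *m x + eps%:M *m u ->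
    y i 0 = x j 0 + eps * u i 0.
  by move/next_stateE->; rewrite eqxx (negPf il) mul1r mul0r mulr0 addr0.
have next_l x u y : y = relay_plant i j l s *m x + eps%:M *m u ->
    y l 0 = s * x i 0 + eps * u l 0.
  move/next_stateE->.
  by rewrite eqxx [l == i]eq_sym (negPf il) mul1r mul0r add0r.
apply: (@bellman_optimal _ _ _ _ _ _ _ V (p + t)) => //.
- by move=> x; rewrite addr_ge0// mulr_ge0// sqr_ge0.
- by rewrite ltr_wpDr.
- move=> x; rewrite mulrDl; apply: lerD; apply: ler_wpM2l => //; exact: sqnorm_ge1.
- move=> x u y y_def; have yE := next_stateE _ _ _ y_def.
  have Ey := sqnorm_ge2 y il; have Eu := sqnorm_ge2 u il.
  have := stage_min (x j 0) (u i 0) Ep; rewrite -(next_i _ _ _ y_def) => yi.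
  have := stage_min (s * x i 0) (u l 0) Ev; rewrite -(next_l _ _ _ y_def) => yl.
  have Ddelta : 0 <= 1 + eps ^+ 2 * (1 + (l == j)%:R * p).
    by rewrite addr_ge0// mulr_ge0 ?(ltW e0)// addr_ge0// mulr_ge0// ler0n.
  have yj : (l == j)%:R * p * y l 0 ^+ 2 <= p * y j 0 ^+ 2.
    case: eqVneq => [->|_]; first by rewrite mul1r.
    by rewrite !mul0r mulr_ge0// sqr_ge0.
  have := mulr_ge0 (ltW D0) (sqr_ge0 (u i 0 + eps * p * x j 0)).
  have := mulr_ge0 Ddelta (sqr_ge0 (u l 0 + eps * v * (s * x i 0))).
  rewrite /V /t; move: yi yl; rewrite /t; lra.
- move=> x u y u_def y_def; have yE := next_stateE _ _ _ y_def.
  have ui : u i 0 = - (eps * p * x j 0).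
    by rewrite u_def KE eqxx (negPf il) mul1r mul0r mulr0 addr0 !mulNr.
  have ul : u l 0 = - (eps * v * (s * x i 0)).
    rewrite u_def KE eqxx [l == i]eq_sym (negPf il) mul1r mul0r mulr0 add0r.
    by rewrite !mulNr !mulrA.
  rewrite (sqnorm_supp2 il (x := y)); last first.
    move=> k /negPf ki /negPf kl.
    by rewrite yE u_def KE ki kl !(mul0r, mulr0, addr0).
  rewrite (sqnorm_supp2 il (x := u)); last first.
    by move=> k /negPf ki /negPf kl; rewrite u_def KE ki kl !(mul0r, mulr0, addr0).
  have := stage_min (x j 0) (u i 0) Ep; rewrite -(next_i _ _ _ y_def) => yi.
  have := stage_min (s * x i 0) (u l 0) Ev; rewrite -(next_l _ _ _ y_def) => yl.
  (* If l differs from j, neither the plant nor the input reaches j, so x_j vanishes after one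
     step. *)
  have yj : (l == j)%:R * p * y l 0 ^+ 2 = p * y j 0 ^+ 2.
    case: eqVneq => [->|lj]; first by rewrite mul1r.
    rewrite (yE j) u_def KE ![j == _]eq_sym (negPf ij) (negPf lj).
    by rewrite !(mul0r, mulr0, addr0) expr0n mulr0.
  move: yi yl; rewrite /V -yj ui ul !addNr expr0n !mulr0 !addr0 /t.
  lra.
Qed.




(** The plant sees the state only through [z = r * x_j + s * x_i], so the cost-to-go is
    [w * z ^+ 2]. *)
Lemma fork_plant_optimal i j (r s : R) : i != j -> r != 0 ->
  exists K w, [/\ 0 < w,
    w <= (1 + s ^+ 2 / (eps ^+ 2 * (r ^+ 2 + s ^+ 2))) / (1 + eps ^+ 2) &
    optimal SK (fork_plant i j r s) eps%:M (delta_mx j 0) K /\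
    cost (fork_plant i j r s) eps%:M (delta_mx j 0) K = (w * r ^+ 2)%:E].
Proof.
move=> ij r0; have [w [a [b [w0 w_le Ea Eb Ew]]]] := fork_riccati_root s eps_gt0 r0.
pose z x := r * x j 0 + s * x i 0.
(* The inputs that drive the next state to [a * z] at i and [b * z] at j. *)
pose K : 'M[R]_n := ((a - 1) / eps) *: fork_plant i j r s
  + (b / eps) *: (r *: delta_mx j j + s *: delta_mx j i).
have KE x k : (K *m x) k 0 =
    (a - 1) / eps * ((k == i)%:R * z x) + b / eps * ((k == j)%:R * z x).
  rewrite mulmxDl -!scalemxAl mxE [X in X + _]mxE fork_plantE.
  rewrite [X in _ + X]mxE mulmxDl -!scalemxAl mxE [X in _ + _ * (X + _)]mxE.
  by rewrite [X in _ + _ * (_ + X)]mxE !delta_mulmxE; rewrite /z; ring.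
have eps0 := lt0r_neq0 eps_gt0.
pose V x : R := w * z x ^+ 2.
have next_stateE x u y : y = fork_plant i j r s *m x + eps%:M *m u ->
    forall k, y k 0 = (k == i)%:R * z x + eps * u k 0.
  by move=> -> k; rewrite mul_scalar_mx mxE fork_plantE mxE.
(* Completing the square around the optimal next state: the Riccati equations remove the linear
   terms, and the excess over [V x] is a nonnegative form in the deviations. *)
have square x u y : y = fork_plant i j r s *m x + eps%:M *m u ->
    (y i 0 ^+ 2 + y j 0 ^+ 2) + (u i 0 ^+ 2 + u j 0 ^+ 2) + V y =
    V x + (1 + eps ^- 2) * ((y i 0 - a * z x) ^+ 2 + (y j 0 - b * z x) ^+ 2)
      + w * (r * (y j 0 - b * z x) + s * (y i 0 - a * z x)) ^+ 2.
  move=> /next_stateE yE.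
  have ui : u i 0 = (y i 0 - z x) / eps.
    by rewrite yE eqxx mul1r addrC addKr mulrC mulKf.
  have uj : u j 0 = y j 0 / eps.
    by rewrite yE eq_sym (negPf ij) mul0r add0r mulrC mulKf.
  rewrite ui uj /V; set yi := y i 0; set yj := y j 0.
  have -> : z y = r * yj + s * yi by [].
  apply/eqP; rewrite -subr_eq0; apply/eqP.
  pose X1 := (1 + eps ^- 2) * a + w * s * (s * a + r * b) - eps ^- 2.
  pose X2 := (1 + eps ^- 2) * b + w * r * (s * a + r * b).
  pose X3 := eps ^- 2 - eps ^- 2 * a - w.
  transitivity (X1 * (2 * z x * yi - a * z x ^+ 2)
    + X2 * (2 * z x * yj - b * z x ^+ 2) + X3 * z x ^+ 2).
    by rewrite /X1 /X2 /X3; field.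
  by rewrite /X1 Ea /X2 Eb /X3 -Ew !subrr !mul0r !addr0.
exists K, w; split => //.
have -> : w * r ^+ 2 = V (delta_mx j 0).
  by rewrite /V /z !mxE eqxx (negPf ij) mulr1 mulr0 addr0.
(* This constant comes from the Cauchy-Schwarz bound on [z x ^+ 2]. *)
have M0 : 0 < 2 * w * (r ^+ 2 + s ^+ 2).
  rewrite mulr_gt0// ?mulr_gt0//.
  by rewrite ltr_pwDl ?sqr_ge0// exprn_even_gt0.
apply: (@bellman_optimal _ _ _ _ _ _ _ V (2 * w * (r ^+ 2 + s ^+ 2))) => //.
- by move=> x; rewrite mulr_ge0 ?sqr_ge0// ltW.
- move=> x; apply: le_trans (_ : 2 * w * (r ^+ 2 + s ^+ 2) *
    (x i 0 ^+ 2 + x j 0 ^+ 2) <= _); last first.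
    by apply: ler_wpM2l; [exact: ltW | exact: sqnorm_ge2].
  rewrite -[2 * w]mulrC -!mulrA ler_wpM2l//; first exact: ltW.
  rewrite /z; set p := x i 0; set p' := x j 0.
  have := sqr_ge0 (r * p - s * p'); have := sqr_ge0 (r * p' + s * p); lra.
- move=> x u y /square E.
  have Ey := sqnorm_ge2 y ij; have Eu := sqnorm_ge2 u ij.
  have ie0 : 0 <= eps ^- 2 by rewrite invr_ge0 sqr_ge0.
  have : 0 <= (1 + eps ^- 2) *
      ((y i 0 - a * z x) ^+ 2 + (y j 0 - b * z x) ^+ 2).
    by rewrite mulr_ge0 ?addr_ge0 ?sqr_ge0.
  have := mulr_ge0 (ltW w0)
    (sqr_ge0 (r * (y j 0 - b * z x) + s * (y i 0 - a * z x))).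
  by move: E; lra.
- move=> x u y u_def y_def; have yE := next_stateE _ _ _ y_def.
  have supp k : k != i -> k != j -> u k 0 = 0 /\ y k 0 = 0.
    move=> /negPf ki /negPf kj.
    by rewrite yE u_def KE ki kj !(mul0r, mulr0, addr0).
  rewrite (sqnorm_supp2 ij (x := y)); last by move=> k ki /(supp _ ki)[].
  rewrite (sqnorm_supp2 ij (x := u)); last by move=> k ki /(supp _ ki)[].
  rewrite (square _ _ _ y_def).
  have -> : y i 0 = a * z x.
    by rewrite yE u_def KE eqxx (negPf ij) mul1r !mul0r; field.
  have -> : y j 0 = b * z x.
    by rewrite yE u_def KE eqxx [j == i]eq_sym (negPf ij) mul1r !mul0r; field.
  by rewrite !subrr !mulr0 addr0 expr0n !(mulr0, addr0).
Qed.
End Plants.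

(** * Block structure and the information constraint *)

Section Structure.
Context (R : realType) (q : nat) (n_ : 'I_q -> nat).
Local Notation n := (\sum_i n_ i)%N.
Local Notation block := tagnat.sig1.

Lemma structuredP (S : 'M[int]_q) (M : 'M[R]_n) :
  (forall a b, S (block a) (block b) = 0 -> M a b = 0) -> structured S M.
Proof.
move=> M0 i j Sij; apply/matrixP => a b; rewrite !mxE.
by apply: M0; rewrite !tagnat.Rank1K.
Qed.

Lemma structured_complete (G : rel 'I_q) (M : 'M[R]_n) :
  complete_graph G -> structured (adjacency G) M.
Proof. by move=> hG i j; rewrite mxE hG. Qed.

Lemma structured_delta (G : rel 'I_q) (a b : 'I_n) (r : R) :
  G (block b) (block a) -> structured (adjacency G) (r *: delta_mx a b).
Proof.
move=> Gba; apply: structuredP => k l; rewrite !mxE.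
case: (k =P a) => [->|_]; last by rewrite mulr0.
by case: (l =P b) => [->|_]; rewrite ?mulr0 // Gba.
Qed.

Lemma structuredD (S : 'M[int]_q) (M N : 'M[R]_n) :
  structured S M -> structured S N -> structured S (M + N).
Proof.
move=> hM hN i j Sij; apply/matrixP => a b.
move/matrixP/(_ a b): (hM i j Sij); move/matrixP/(_ a b): (hN i j Sij).
by rewrite !mxE => -> ->; rewrite addr0.
Qed.

Lemma input_matrices_scalar (eps : R) : input_matrices eps (eps%:M : 'M[R]_n).
Proof.
by split; [exact: scalar_mx_is_diag | move=> k; rewrite mxE eqxx].
Qed.

(** The identity design graph enters the lower bounds only here: an adversary may alter [A] in other
    block rows without moving the gains in row [a]. *)
Lemma design_method_row SP SK (eps : R) Gamma (A A' B : 'M[R]_n) (a : 'I_n) :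
  design_method SP SK 1%:M eps Gamma ->
  structured SP A -> structured SP A' -> input_matrices eps B ->
  (forall k, block k = block a -> row k A = row k A') ->
  row a (Gamma A B) = row a (Gamma A' B).
Proof.
move=> [_ hG] hA hA' hB rows.
have /(_ _)/matrixP := hG (block a) A B A' B hA hB hA' hB.
move=> /(_ _ (tagnat.sig2 a)) E; apply/rowP => b.
have := E _ b; rewrite !mxE tagnat.sig2K; apply=> j.
rewrite mxE; case: (_ =P j) => // <- _; split=> //.
apply/matrixP => k l; rewrite !mxE.
by have /rowP/(_ l) := rows (tagnat.Rank _ k) (tagnat.Rank1K k); rewrite !mxE.
Qed.

End Structure.

(** * Lower bounds from the two families *)

Section LowerBounds.
Context (R : realType) (q : nat) (n_ : 'I_q -> nat).
Context (GP GK : rel 'I_q) (eps : R).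
Local Notation n := (\sum_i n_ i)%N.
Local Notation block := tagnat.sig1.
Context (Gamma : 'M[R]_n -> 'M[R]_n -> 'M[R]_n).
Context (GK_complete : complete_graph GK) (eps_gt0 : 0 < eps).
Context (Gamma_design :
  design_method (adjacency GP) (adjacency GK) 1%:M eps Gamma).
Implicit Types i j l k : 'I_n.

Let SK_full (K : 'M[R]_n) : structured (adjacency GK) K.
Proof. exact: structured_complete. Qed.

Local Notation ratio := (competitive_ratio (adjacency GP) (adjacency GK) eps Gamma).

Lemma relay_lower_bound i j l : block i != block j -> block i != block l ->
  GP (block j) (block i) -> GP (block i) (block l) ->
  ((1 + 1 / eps ^+ 2)%:E <= ratio)%E.
Proof.
move=> ij il Gji Gil.
have nij : i != j by apply: contraNneq ij => ->.
have nil : i != l by apply: contraNneq il => ->.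
have e0 : 0 < eps ^+ 2 by rewrite exprn_gt0.
have struct (s : R) : structured (adjacency GP) (relay_plant i j l s).
  rewrite /relay_plant -[delta_mx i j]scale1r.
  by apply: structuredD; apply: structured_delta.
(* The gain from x_j to u_i. From x(0) = e_j it gives x_i(1) = [1 + eps * kappa] for every [s]. *)
pose kappa := Gamma (relay_plant i j l 0) eps%:M i j.
have kappaE s : Gamma (relay_plant i j l s) eps%:M i j = kappa.
  have /rowP/(_ j) : row i (Gamma (relay_plant i j l s) eps%:M)
      = row i (Gamma (relay_plant i j l 0) eps%:M).
    apply: design_method_row Gamma_design (struct _) (struct _) _ _.
      exact: input_matrices_scalar.
    move=> k ki; apply/rowP => b; rewrite !mxE.
    have /negPf -> : k != l by apply: contraNneq il => <-; rewrite ki.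
    by rewrite !mulr0.
  by rewrite !mxE.
have colM (M : 'M[R]_n) k : (M *m (delta_mx j 0 : 'cV_n)) k 0 = M k j.
  by rewrite -colE mxE.
(* If x_i(1) is cancelled, the plant with [s = 0] already gives the bound, from the first input
   alone. *)
have [kappa0|kappa_neq0] := eqVneq (1 + eps * kappa) 0.
  have [K [p [p0 _ /(_ erefl) pE opt]]] :=
    relay_plant_optimal SK_full eps_gt0 0 nij nil.
  apply: competitive_ratio_ge (struct 0) (input_matrices_scalar _ _) opt p0 _.
  apply: le_trans (cost_ge_input _ _ _ _ i); rewrite lee_fin colM kappaE.
  have -> : kappa = - eps^-1.
    by apply: (mulfI (lt0r_neq0 eps_gt0)); rewrite mulrN divff ?lt0r_neq0//; lra.
  rewrite pE sqrrN exprVn le_eqVlt; apply/orP; left; apply/eqP.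
  by field; rewrite lt0r_neq0// lt0r_neq0// addr_gt0.
pose rho := 1 + 1 / eps ^+ 2.
(* This [s] makes the signal [s * x_i(1)] reaching l equal to [rho]. *)
pose s := rho / (1 + eps * kappa).
have [K [p [p0 p_le _ opt]]] := relay_plant_optimal SK_full eps_gt0 s nij nil.
apply: competitive_ratio_ge (struct s) (input_matrices_scalar _ _) opt p0 _.
set G := Gamma _ _; set A := relay_plant _ _ _ _.
apply: le_trans (cost_ge2 _ _ _ _ i l); rewrite lee_fin -/rho.
set x1 := trajectory A eps%:M (delta_mx j 0) G 1.
have x1E : x1 i 0 = 1 + eps * kappa.
  rewrite /x1 /= mul_scalar_mx mxE relay_plantE [X in _ + X]mxE colM /G kappaE.
  by rewrite !mxE !eqxx (negPf nil) mul0r mulr0 addr0 mulr1.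
have -> : trajectory A eps%:M (delta_mx j 0) G 2 l 0
    = rho + eps * input A eps%:M (delta_mx j 0) G 1 l 0.
  rewrite -[trajectory _ _ _ _ 2]/(A *m x1 + eps%:M *m (G *m x1)).
  rewrite mul_scalar_mx mxE relay_plantE mxE x1E eqxx eq_sym (negPf nil).
  by rewrite mul0r add0r mul1r divfK// mxE.
set u := input _ _ _ _ 1 l 0.
have e1 : 0 < 1 + eps ^+ 2 by rewrite addr_gt0.
(* Whatever u_l(1) is, the second step costs at least [rho ^+ 2 / (1 + eps ^+ 2) = rho / eps ^+ 2],
   and the optimum is at most [eps ^- 2]. *)
have := @stage_min _ eps 1 (1 + eps ^+ 2)^-1 rho u.
rewrite !mulr1 mul1r mulVf ?lt0r_neq0// => -> //.
apply: (@le_trans _ _ (rho * eps ^- 2)).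
  by rewrite ler_wpM2l// addr_ge0// divr_ge0// ltW.
have -> : rho * eps ^- 2 = (1 + eps ^+ 2)^-1 * rho ^+ 2.
  by rewrite /rho; field; rewrite !lt0r_neq0.
by rewrite addrCA lerDl addr_ge0 ?sqr_ge0// mulr_ge0 ?sqr_ge0// ltW.
Qed.

Lemma fork_lower_bound i j : block i != block j ->
  GP (block j) (block i) -> GP (block i) (block i) ->
  ((1 + 1 / eps ^+ 2)%:E <= ratio)%E.
Proof.
move=> ij Gji Gii.
have nij : i != j by apply: contraNneq ij => ->.
have e0 : 0 < eps ^+ 2 by rewrite exprn_gt0.
have e1 : 0 < 1 + eps ^+ 2 by rewrite addr_gt0.
have struct (r s : R) : structured (adjacency GP) (fork_plant i j r s).
  by apply: structuredD; apply: structured_delta.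
(* The block row of j is zero for all [r] and [s], so this gain is fixed, and x_j(1) = [eps * c]. *)
pose c := Gamma (fork_plant i j 0 0) eps%:M j j.
have cE r s : Gamma (fork_plant i j r s) eps%:M j j = c.
  have /rowP/(_ j) : row j (Gamma (fork_plant i j r s) eps%:M)
      = row j (Gamma (fork_plant i j 0 0) eps%:M).
    apply: design_method_row Gamma_design (struct _ _) (struct _ _) _ _.
      exact: input_matrices_scalar.
    move=> k kj; apply/rowP => b; rewrite !mxE.
    have /negPf -> : k != i by apply: contraNneq ij => <-; rewrite kj.
    by rewrite !mulr0.
  by rewrite !mxE.
have colM (M : 'M[R]_n) k : (M *m (delta_mx j 0 : 'cV_n)) k 0 = M k j.
  by rewrite -colE mxE.
(* The fork reaches the bound only in the limit, so it is proved up to an arbitrary [d > 0]. *)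
apply/lee_subgt0Pr => d d0; rewrite -EFinB.
set rho := 1 + 1 / eps ^+ 2.
have rho0 : 0 < rho by rewrite addr_gt0// divr_gt0.
(* The common value of [r] and [s ^+ 2], chosen so that [d * eps ^+ 2 * S] cancels the lower-order
   terms at the end. *)
pose S := rho * (1 + eps ^+ 2 + rho) / (d * eps ^+ 2).
have S0 : 0 < S by rewrite divr_gt0// mulr_gt0// addr_gt0.
(* With [c * s >= 0], x_j(1) pushes x_i(2) in the same direction as the uncontrolled signal does. *)
have [s sS cs] : exists2 s, s ^+ 2 = S & 0 <= c * s.
  have sS := sqr_sqrtr (ltW S0); have := sqrtr_ge0 S.
  have [c0|/ltW c0] := leP 0 c; [exists (Num.sqrt S) | exists (- Num.sqrt S)] => //.
  - exact: mulr_ge0.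
  - by rewrite sqrrN.
  - by rewrite mulrN oppr_ge0 mulr_le0_ge0.
have s0 : s != 0 by rewrite -sqrf_eq0 sS lt0r_neq0.
have S_neq0 := lt0r_neq0 S0.
have [K [w [w0 w_le opt]]] :=
  fork_plant_optimal SK_full eps_gt0 s nij S_neq0.
apply: competitive_ratio_ge (struct S s) (input_matrices_scalar _ _) opt _ _.
  by rewrite mulr_gt0// exprn_gt0.
set G := Gamma _ _; set A := fork_plant _ _ _ _.
apply: le_trans (cost_ge2 _ _ _ _ i i); rewrite lee_fin.
set u0 := input A eps%:M (delta_mx j 0) G 0 i 0.
set u1 := input A eps%:M (delta_mx j 0) G 1 i 0.
set x1 := trajectory A eps%:M (delta_mx j 0) G 1.
have x1j : x1 j 0 = eps * c.
  rewrite /x1 /= mul_scalar_mx mxE fork_plantE [X in _ + X]mxE colM /G cE.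
  by rewrite eq_sym (negPf nij) mul0r add0r.
have x1i : x1 i 0 = S + eps * u0.
  rewrite /x1 /= mul_scalar_mx mxE fork_plantE [X in _ + X]mxE.
  rewrite eqxx mul1r; congr (_ + _).
  by rewrite !mxE !eqxx (negPf nij) mulr1 mulr0 addr0.
have -> : trajectory A eps%:M (delta_mx j 0) G 2 i 0
    = S * (eps * c) + s * (S + eps * u0) + eps * u1.
  rewrite -[trajectory _ _ _ _ 2]/(A *m x1 + eps%:M *m (G *m x1)).
  by rewrite mul_scalar_mx mxE fork_plantE x1i x1j eqxx mul1r [X in _ + X]mxE.
(* Backward minimisation: [beta] is the weight left after minimising over u_i(1), and [v] the one
   left after minimising over u_i(0) as well. Here x_i(2) = [s * (t + eps * u0) + eps * u1]. *)
pose beta := S / (1 + eps ^+ 2).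
have beta0 : 0 < beta by rewrite divr_gt0.
have D0 : 0 < 1 + eps ^+ 2 + eps ^+ 2 * S by rewrite addr_gt0// mulr_gt0.
pose v := S / (1 + eps ^+ 2 + eps ^+ 2 * S).
have v0 : 0 < v by rewrite divr_gt0.
pose t := S + eps * (c * s).
apply: (@le_trans _ _ (v * t ^+ 2)); last first.
  have E1 := @stage_min _ eps 1 (1 + eps ^+ 2)^-1
    (S * (eps * c) + s * (S + eps * u0)) u1.
  have E2 := @stage_min _ eps beta v t u0.
  rewrite mul1r in E1; rewrite E1; last by rewrite mulr1 mulVf// lt0r_neq0.
  have -> : S * (eps * c) + s * (S + eps * u0) = s * (t + eps * u0).
    by rewrite /t -sS; ring.
  have -> : (1 + eps ^+ 2)^-1 * (s * (t + eps * u0)) ^+ 2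
      = beta * (t + eps * u0) ^+ 2 by rewrite /beta -sS; ring.
  rewrite addrA E2; last first.
    by rewrite /v /beta; field; rewrite !lt0r_neq0.
  have c0 : 0 <= 1 + eps ^+ 2 * beta by rewrite ltW// addr_gt0// mulr_gt0.
  have c1 : 0 <= 1 + eps ^+ 2 * 1 by rewrite mulr1 ltW.
  by rewrite -addrA lerDl; apply: addr_ge0; rewrite mulr_ge0// sqr_ge0.
have t_ge : S <= t by rewrite lerDl mulr_ge0// ltW.
apply: (@le_trans _ _ (v * S ^+ 2)); last first.
  by rewrite ler_wpM2l ?ler_sqr ?nnegrE ?(ltW S0) ?(ltW v0)// (le_trans _ t_ge)// ltW.
rewrite mulrA ler_wpM2r ?sqr_ge0//.
have [rd|rd] := leP (rho - d) 0.
  by apply: le_trans (ltW v0); rewrite mulr_le0_ge0// ltW.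
apply: (le_trans (ler_wpM2l (ltW rd) w_le)).
have S1 : 0 < 1 + S by rewrite addr_gt0.
rewrite /v ler_pdivlMr//.
(* With [r = s ^+ 2 = S] the bound on [w] splits off a negative term, which is then dropped. *)
have -> : (rho - d) * ((1 + s ^+ 2 / (eps ^+ 2 * (S ^+ 2 + s ^+ 2))) / (1 + eps ^+ 2))
  * (1 + eps ^+ 2 + eps ^+ 2 * S) =
  (rho - d) * (1 + eps ^+ 2 + eps ^+ 2 * S + rho - S / (eps ^+ 2 * (1 + S)))
    / (1 + eps ^+ 2).
  by rewrite sS /rho; field; rewrite !lt0r_neq0// addr_gt0// exprn_gt0.
rewrite ler_pdivrMr//.
apply: (@le_trans _ _ ((rho - d) * (1 + eps ^+ 2 + eps ^+ 2 * S + rho))).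
  by rewrite ler_wpM2l ?(ltW rd)// gerBl divr_ge0// ltW// mulr_gt0.
have dS : d * eps ^+ 2 * S = rho * (1 + eps ^+ 2 + rho).
  by rewrite /S mulrC divfK// lt0r_neq0// mulr_gt0.
have rhoe : rho * eps ^+ 2 = 1 + eps ^+ 2.
  by rewrite /rho; field; rewrite lt0r_neq0.
have -> : (rho - d) * (1 + eps ^+ 2 + eps ^+ 2 * S + rho) =
    rho * (1 + eps ^+ 2 + rho) - d * eps ^+ 2 * S + rho * eps ^+ 2 * S
      - d * (1 + eps ^+ 2 + rho) by ring.
rewrite dS subrr add0r rhoe mulrC gerBl mulr_ge0 ?(ltW d0)//.
by rewrite addr_ge0 ?(ltW rho0)// ltW.
Qed.


End LowerBounds.

(* The number of vertices is q = m + c, the c sinks being the last c vertices,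
   so that ulsubmx and drsubmx are the diagonal blocks of S_P. *)
Theorem theorem3p20 (R : realType) (m c : nat) (n_ : 'I_(m + c) -> nat) (eps : R)
    (GP GK GC : rel 'I_(m + c))
    (hn : forall i, (1 <= n_ i)%N)
    (heps : 0 < eps)
    (hc : (1 <= c)%N)
    (hsink : forall i : 'I_(m + c), sink GP i <-> (m <= i)%N)
    (hiso : forall i, ~~ isolated_vertex GP i)
    (hK : complete_graph GK)
    (hC : adjacency GC = 1%:M)
    (hS : ~~ is_diag_mx (ulsubmx (adjacency GP)) \/
          drsubmx (adjacency GP) <> 0)
    (Gamma : 'M[R]_(\sum_i n_ i) -> 'M[R]_(\sum_i n_ i) -> 'M[R]_(\sum_i n_ i))
    (hGamma : design_method (adjacency GP) (adjacency GK) (adjacency GC) eps Gamma) :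
  ((1 + 1 / eps ^+ 2)%:E <=
     competitive_ratio (adjacency GP) (adjacency GK) eps Gamma)%E.
Proof.
rewrite hC in hGamma.
(* The first coordinate of each block, available since every [n_ i] is positive. *)
pose idx i : 'I_(\sum_i n_ i) := tagnat.Rank i (Ordinal (hn i)).
have idxK i : tagnat.sig1 (idx i) = i by exact: tagnat.Rank1K.
have sinkN a b : b != a -> sink GP a -> ~~ GP a b.
  by move=> ba /forallP/(_ b)/implyP; exact.
case: hS => [/is_diag_mxP ndiag|nz].
(* An off-diagonal entry is an edge from j to i between distinct non-sinks. As i is not a sink it
   has a successor l, possibly j itself, which gives a relay. *)
- have [i [j [ij Gji]]] : exists i j, i != j /\ GP (lshift c j) (lshift c i).
    apply: contrapT => h; apply: ndiag => i j ij; apply: contrapT => /eqP nz.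
    by apply: h; exists i, j; split=> //; move: nz; rewrite !mxE; case: ifP.
  have : ~~ sink GP (lshift c i) by apply/negP => /hsink; rewrite leqNgt /= ltn_ord.
  rewrite negb_forall => /existsP[l]; rewrite negb_imply negbK => /andP[li Gil].
  apply: (@relay_lower_bound _ _ _ _ _ _ _ hK heps hGamma
    (idx (lshift c i)) (idx (lshift c j)) (idx l)); rewrite !idxK//.
  by rewrite eq_sym.
(* An edge between sinks must be a self-loop. The sink is not isolated, so another vertex j feeds
   it, which gives a fork. *)
have [a [b Gba]] : exists a b, GP (rshift m b) (rshift m a).
  apply: contrapT => h; apply: nz; apply/matrixP => a b.
  apply: contrapT => nab; apply: h; exists a, b.
  by move: nab; rewrite !mxE; case: ifP.
have sink_r k : sink GP (rshift m k) by apply/hsink; rewrite leq_addr.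
have ba : rshift m b = rshift m a.
  by apply/eqP; apply: contraTT Gba => ba; apply: sinkN => //; rewrite eq_sym.
rewrite ba in Gba.
have := hiso (rshift m a); rewrite negb_forall => /existsP[j].
rewrite negb_imply negb_and !negbK => /andP[ja].
rewrite (negPf (sinkN _ _ ja (sink_r a))) /= => Gja.
apply: (@fork_lower_bound _ _ _ _ _ _ _ hK heps hGamma
  (idx (rshift m a)) (idx j)); rewrite !idxK//.
by rewrite eq_sym.
Qed.
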